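(* The following assertions hold. (a) If $T\in\mathcal{T}$ and $\lambda\geq 0$, then $\lambda T\in\mathcal{T}$. (b) If $T_1,T_2\in\mathcal{T}$, then $T_1+T_2\in\mathcal{T}$. (c) If $T\in\mathcal{T}$, then $T^{-1}\in\mathcal{T}$. (d) If $T\in\mathcal{T}$ and $\lambda>0$, then $(I+\lambda T)^{-1}\in\mathcal{T}$, where $I$ is the identity operator on $\mathbb{R}$. (e) If $T_1,T_2\in\mathcal{T}$, then $(T_1^{-1}+T_2^{-1})^{-1}\in\mathcal{T}$.
   Context: **Set-valued operators.** Let $T:\mathbb{R}\rightrightarrows\mathbb{R}$ be a set-valued map with $\operatorname{dom} T=\{x: Tx\neq\emptyset\}$ and $\operatorname{gph} T=\{(x,y): y\in Tx\}$. Operations: $(\lambda T)(x)=\{\lambda y: y\in Tx\}$; $(T_1+T_2)(x)=\{y_1+y_2: y_1\in T_1x,\ y_2\in T_2x\}$; $T^{-1}(y)=\{x: y\in Tx\}$. (In particular the first two are empty when one of the sets involved is empty.) **Monotone operators.** $T$ is monotone if $(x-y)(x^+-y^+)\ge 0$ for all $(x,x^+),(y,y^+)\in\operatorname{gph} T$; it is strictly monotone if the inequality is strict whenever $x\neq y$; it is maximal monotone if it is monotone and no monotone operator has a graph properly containing $\operatorname{gph} T$. A maximal monotone extension of $T$ is a maximal monotone operator $\widetilde{T}$ with $\operatorname{gph} T\subseteq\operatorname{gph}\widetilde{T}$. **The class $\mathcal{T}$.** For a finite set $B=\{b_i\}_{i=0}^l$ with $b_0=-\infty<b_1<\dots<b_{l-1}<b_l=+\infty$,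 a set-valued operator $T:\mathbb{R}\rightrightarrows\mathbb{R}$ belongs to $\mathcal{T}(B)$ if there exists a maximal monotone extension $\widetilde{T}$ of $T$ such that the restriction of $\widetilde{T}$ to each interval $(b_i,b_{i+1})$ is either (i) single-valued and constant; (ii) single-valued, continuous and strictly monotone; or (iii) identically equal to the empty set. The class $\mathcal{T}$ is the union of $\mathcal{T}(B)$ over all such finite sets $B$. (Neither the operator $T$ itself nor its domain is required to be maximal or nonempty; e.g. the empty relation is in $\mathcal{T}$.) *)

(* Defs.v *)
From HB Require Import structures.
From mathcomp Require Import all_boot all_order all_algebra.
From mathcomp Require Import all_classical all_reals all_analysis.
Import Order.TTheory GRing.Theory Num.Theory.
Import numFieldNormedType.Exports.

Set Implicit Arguments.
Unset Strict Implicit.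
Unset Printing Implicit Defensive.

Local Open Scope classical_set_scope.
Local Open Scope ring_scope.

Section Operators.
Variable R : realType.

(* A set-valued map is a function into sets; [T x = set0] when x lies outside
   the domain of T. *)
Definition operator := R -> set R.

Implicit Types (T S : operator) (D : set R).

Definition gph T : set (R * R) := [set p | T p.1 p.2].

Definition op_id : operator := fun x => [set x].

Definition op_scale (a : R) T : operator := fun x => [set a * y | y in T x].

Definition op_add T1 T2 : operator :=
  fun x => [set y1 + y2 | y1 in T1 x & y2 in T2 x].

Definition op_inv T : operator := fun y => [set x | T x y].

Definition op_restrict T D : operator := fun x => [set y | D x /\ T x y].

Definition monotone T :=
  forall p q : R * R, gph T p -> gph T q ->
    0 <= (p.1 - q.1) * (p.2 - q.2).

Definition strictly_monotone T :=
  forall p q : R * R, gph T p -> gph T q -> p.1 != q.1 ->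
    0 < (p.1 - q.1) * (p.2 - q.2).

Definition maximal_monotone T :=
  monotone T /\ ~ (exists2 S, monotone S & gph T `<` gph S).

Definition maximal_monotone_extension T S :=
  maximal_monotone S /\ gph T `<=` gph S.

(* T is single-valued on D: at every point x of D, T x is the singleton of
   f x; the values of f outside D are irrelevant. *)
Definition single_valued_on D T (f : R -> R) :=
  forall x, D x -> T x = [set f x].

Definition constant_piece D T := exists c : R, single_valued_on D T (cst c).

Definition strict_piece D T :=
  exists f : R -> R,
    [/\ single_valued_on D T f, {within D, continuous f}
      & strictly_monotone (op_restrict T D)].

Definition empty_piece D T := forall x, D x -> T x = set0.

(* The finite set -oo = b_0 < b_1 < ... < b_l = +oo is given by l and the first
   l + 1 terms of a sequence in the extended reals. The conditions force
   0 < l, and b_i finite for 0 < i < l. *)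
Definition breakpoints (l : nat) (b : nat -> \bar R) :=
  [/\ b 0%N = -oo%E, b l = +oo%E
    & forall i : nat, (i < l)%N -> (b i < b i.+1)%E].

Definition piece (b : nat -> \bar R) (i : nat) : set R :=
  [set x | (b i < x%:E)%E /\ (x%:E < b i.+1)%E].

Definition classT_of (l : nat) (b : nat -> \bar R) T :=
  exists2 S, maximal_monotone_extension T S &
    forall i : nat, (i < l)%N ->
      [\/ constant_piece (piece b i) S, strict_piece (piece b i) S
        | empty_piece (piece b i) S].

Definition classT T :=
  exists (l : nat) (b : nat -> \bar R), breakpoints l b /\ classT_of l b T.

End Operators.

(* Main.v *)
(* A monotone operator S on the line is maximal iff I + S is surjective, so its
   graph is the curve t |-> (J t, t - J t), where J is nondecreasing and
   1-Lipschitz; the intermediate value theorem along such curves gives the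
   maximality of S1 + S2 as soon as the domains meet (otherwise T1 + T2 is empty
   and extended by the zero operator).

   Membership in the class amounts to having a finite set that cuts the line into
   open intervals of uniform behaviour, the continuity being automatic. For sums
   one takes the union of the two sets. For the inverse, each piece and each
   breakpoint has an interval as its image under S, and one takes all the
   endpoints of these images: an interval avoiding them is contained in a single
   image or disjoint from the range of S. Parts (d) and (e) follow from
   (a), (b), (c). *)
Require Import Defs.
From HB Require Import structures.
From mathcomp Require Import all_boot all_order all_algebra.
From mathcomp Require Import all_classical all_reals all_analysis.
From mathcomp Require Import lra.
Import Order.TTheory GRing.Theory Num.Theory.
Import numFieldNormedType.Exports.

Set Implicit Arguments.
Unset Strict Implicit.
Unset Printing Implicit Defensive.

Local Open Scope classical_set_scope.
Local Open Scope ring_scope.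

(* The library has another [monotone], for families of sets. *)
Local Notation monotone := Defs.monotone.

Section MaximalMonotone.
Variable R : realType.
Implicit Types (S T : operator R) (K D : set R) (x y z t : R).

(** * Maximality criteria, surjectivity of I + S, and resolvents *)

Lemma monotone_le S x x' y y' :
  monotone S -> S x y -> S x' y' -> x < x' -> y <= y'.
Proof.
move=> mS Sxy Sx'y' ltxx'; have /= := mS (x, y) (x', y') Sxy Sx'y'.
by rewrite nmulr_rge0 ?subr_le0 // subr_lt0.
Qed.

Lemma le_monotone S :
  (forall x x' y y', S x y -> S x' y' -> x < x' -> y <= y') -> monotone S.
Proof.
move=> leS [x y] [x' y']; rewrite /gph /= => Sxy Sx'y'.
have [xx'|xx'|->] := ltgtP x x'; last by rewrite subrr mul0r.
- by rewrite mulr_le0 // subr_le0 ?(leS _ _ _ _ Sxy Sx'y' xx') // ltW.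
- by rewrite mulr_ge0 // subr_ge0 ?(leS _ _ _ _ Sx'y' Sxy xx') // ltW.
Qed.

(** Otherwise adding (x, y) to the graph would give a proper monotone extension. *)
Lemma maximal_mem S x y : maximal_monotone S ->
  (forall u v, S u v -> 0 <= (x - u) * (y - v)) -> S x y.
Proof.
move=> [mS maxS] relxy; apply: contrapT => nSxy; apply: maxS.
exists (fun a => [set b | S a b \/ (a = x /\ b = y)]).
- move=> [a b] [a' b']; rewrite /gph /=.
  move=> [Sab|[-> ->]] [Sa'b'|[-> ->]].
  + exact: (mS (a, b) (a', b')).
  + by have := relxy _ _ Sab; rewrite -(opprB x) -(opprB y) mulrNN.
  + exact: relxy.
  + by rewrite subrr mul0r.
- split; first by move=> [a b]; rewrite /gph /=; left.
  by move=> /(_ (x, y)); rewrite /gph /= => /(_ (or_intror (conj erefl erefl))).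
Qed.

Lemma maximal_monotoneI S : monotone S ->
  (forall x y, (forall u v, S u v -> 0 <= (x - u) * (y - v)) -> S x y) ->
  maximal_monotone S.
Proof.
move=> mS memS; split=> // -[S' mS' [SS' nS'S]]; apply: nS'S => -[x y] S'xy.
by apply: memS => u v Suv; exact: (mS' (x, y) (u, v) S'xy (SS' (u, v) Suv)).
Qed.

(** A point (x, y) related to the whole graph is related to a graph point (u, v) with u + v = x + y.
    There the product is -(x - u)^2, which forces x = u and y = v. *)
Lemma surj_maximal S : monotone S -> (forall t, exists x, S x (t - x)) ->
  maximal_monotone S.
Proof.
move=> mS surjS; apply: maximal_monotoneI => // x y relxy.
have [u Su] := surjS (x + y); have := relxy _ _ Su.
have -> : y - (x + y - u) = - (x - u) by lra.
rewrite mulrN oppr_ge0 -expr2 => sqle0.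
have : (x - u) ^+ 2 == 0 by rewrite eq_le sqle0 sqr_ge0.
rewrite sqrf_eq0 subr_eq0 => /eqP xu.
by move: Su; rewrite -xu; have -> : x + y - x = y by lra.
Qed.

(* In the coordinates (x, x + y), the points monotonically related to (u, v)
   over t are those with x between u and t - v, and monotonicity says exactly
   that these segments meet pairwise. *)
Lemma minty S t : maximal_monotone S -> exists x, S x (t - x).
Proof.
move=> maxS; have [mS _] := maxS.
have meet u v u' v' : S u v -> S u' v' ->
    Num.min u (t - v) <= Num.max u' (t - v').
  move=> Suv Su'v'; rewrite ge_min !le_max.
  case: (leP u u') => //= u'u; have := monotone_le mS Su'v' Suv u'u.
  by move=> vv'; have -> : t - v <= t - v' => [|]; [lra|rewrite !orbT].
have [[u0 [v0 S0]]|nS] := pselect (exists u v, S u v); last first.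
  by exists 0; apply: (maximal_mem maxS) => u v Suv; case: nS; exists u, v.
(* Segments of the line that meet pairwise have a common point, namely the supremum of their left
   ends. *)
pose E := [set m | exists u v, S u v /\ m = Num.min u (t - v)].
exists (sup E); apply: (maximal_mem maxS) => u v Suv.
have lo : Num.min u (t - v) <= sup E.
  apply: ub_le_sup; last by exists u, v.
  by exists (Num.max u0 (t - v0)) => _ [u' [v' [S' ->]]]; exact: meet.
have hi : sup E <= Num.max u (t - v).
  apply: ge_sup; first by exists (Num.min u0 (t - v0)), u0, v0.
  by move=> _ [u' [v' [S' ->]]]; exact: meet.
have [utv|tvu] := leP u (t - v).
- by move: lo hi; rewrite (min_idPl utv) (max_idPr utv) => lo hi; nra.
- have tvu' := ltW tvu; move: lo hi.
  by rewrite (min_idPr tvu') (max_idPl tvu') => lo hi; nra.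
Qed.

Definition nondecreasing_nonexpansive (f : R -> R) :=
  forall a b, a <= b -> f a <= f b <= f a + (b - a).

Lemma nonexpansive_IVT f a b v : nondecreasing_nonexpansive f ->
  a <= b -> f a <= v <= f b -> exists2 c, a <= c <= b & f c = v.
Proof.
move=> nef ab fv; have [/andP[fab _]] := nef _ _ ab.
have cf : continuous f.
  move=> x; apply/cvgrPdist_le => e e0; near=> z.
  have xz : `|x - z| <= e by near: z; exact: cvgr_dist_le.
  by have [zx|/ltW zx] := leP z x; have := nef _ _ zx; move: xz;
    rewrite !ler_norml; lra.
have [|c] := @IVT R f a b v ab (continuous_subspaceT cf).
  by rewrite (min_idPl fab) (max_idPr fab).
by rewrite in_itv /= => ? <-; exists c.
Unshelve. all: by end_near. Qed.

(** J is (I + S)^-1. Two graph points with the same sum of coordinates coincide by monotonicity; the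
    two bounds say that both J t and t - J t are nondecreasing. *)
Lemma resolvent_exists S : maximal_monotone S ->
  exists J : R -> R, [/\ forall t, S (J t) (t - J t),
    forall x y, S x y -> J (x + y) = x
    & nondecreasing_nonexpansive J].
Proof.
move=> maxS; have [mS _] := maxS.
have [J SJ] := choice (fun t => minty t maxS).
exists J; split=> //.
- move=> x y Sxy; have := SJ (x + y) => SJt.
  have [h|h|//] := ltgtP (J (x + y)) x.
  + by have := monotone_le mS SJt Sxy h; lra.
  + by have := monotone_le mS Sxy SJt h; lra.
- move=> a b ab; have [h|h|->] := ltgtP (J a) (J b); last by lra.
  + by have := monotone_le mS (SJ a) (SJ b) h; lra.
  + by have := monotone_le mS (SJ b) (SJ a) h; lra.
Qed.

(** * Operations preserving maximality *)

Lemma op_addP S T x y : op_add S T x y <->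
  exists y1 y2, [/\ S x y1, T x y2 & y = y1 + y2].
Proof.
split; first by move=> [y1 S1 [y2 S2 <-]]; exists y1, y2.
by move=> [y1 [y2 [S1 S2 ->]]]; exists y1 => //; exists y2.
Qed.

Lemma monotone_add S T : monotone S -> monotone T -> monotone (op_add S T).
Proof.
move=> mS mT; apply: le_monotone => x x' y y'.
move=> /op_addP[a [b [Sa Tb ->]]] /op_addP[a' [b' [Sa' Tb' ->]]] xx'.
by apply: lerD; [exact: monotone_le Sa Sa' xx'|exact: monotone_le Tb Tb' xx'].
Qed.

(* With resolvents J1 and J2, solving t \in x + S x + T x amounts to finding a
   zero of phi a = J1 a - J2 (t + J1 a - a), which is again nondecreasing and
   nonexpansive; a common point of the domains locates a sign change. *)
Lemma maximal_add S T x0 y1 y2 : maximal_monotone S -> maximal_monotone T ->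
  S x0 y1 -> T x0 y2 -> maximal_monotone (op_add S T).
Proof.
move=> maxS maxT S0 T0; apply: surj_maximal.
  by apply: monotone_add; [case: maxS|case: maxT].
move=> t.
have [J1 [SJ J1x ne1]] := resolvent_exists maxS.
have [J2 [TJ J2x ne2]] := resolvent_exists maxT.
pose phi a := J1 a - J2 (t + J1 a - a).
have nephi : nondecreasing_nonexpansive phi.
  move=> a b ab; have := ne1 _ _ ab; rewrite /phi => h1.
  have /ne2 : t + J1 b - b <= t + J1 a - a by lra.
  by lra.
have [a phia] : exists a, phi a = 0.
  have Ja := J1x _ _ S0; have Jb := J2x _ _ T0.
  set a0 := x0 + y1 in Ja; set b0 := x0 + y2 in Jb.
  (* With d = J1 a1 - J1 a0, one has phi a0 = J2 b0 - J2 (b0 + (a1 - a0)) and phi a1 = d + J2 b0 -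
     J2 (b0 + d), which have opposite weak signs. *)
  pose a1 := t + x0 - b0.
  have [h|/ltW h] := leP a0 a1.
  - have [|c _ hc] := @nonexpansive_IVT phi a0 a1 0 nephi h; last by exists c.
    rewrite /phi Ja; have := ne1 _ _ h.
    have /ne2 : b0 <= t + x0 - a0 by rewrite /a1 in h; lra.
    have /ne2 : b0 <= t + J1 a1 - a1 by have := ne1 _ _ h; rewrite /a1; lra.
    by rewrite Ja Jb /a1; lra.
  - have [|c _ hc] := @nonexpansive_IVT phi a1 a0 0 nephi h; last by exists c.
    rewrite /phi Ja; have := ne1 _ _ h.
    have /ne2 : t + x0 - a0 <= b0 by rewrite /a1 in h; lra.
    have /ne2 : t + J1 a1 - a1 <= b0 by have := ne1 _ _ h; rewrite /a1; lra.
    by rewrite Ja Jb /a1; lra.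
exists (J1 a); apply/op_addP; exists (a - J1 a), (t - a).
split=> //; last by lra.
have := TJ (t + J1 a - a); have -> : J2 (t + J1 a - a) = J1 a.
  by move: phia; rewrite /phi; lra.
by have -> : t + J1 a - a - J1 a = t - a by lra.
Qed.

Lemma maximal_inv S : maximal_monotone S -> maximal_monotone (op_inv S).
Proof.
move=> maxS; have [mS _] := maxS; apply: surj_maximal.
- move=> [x y] [x' y'] Sp Sq; rewrite mulrC.
  exact: (mS (y, x) (y', x') Sp Sq).
- move=> t; have [x Sx] := minty t maxS; exists (t - x); rewrite /op_inv /=.
  by have -> : t - (t - x) = x by lra.
Qed.

(** Scaling does not preserve the sums x + y, but it multiplies the products that test relatedness
    by c. *)
Lemma maximal_scale S c : 0 < c -> maximal_monotone S ->
  maximal_monotone (op_scale c S).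
Proof.
move=> c0 maxS; have [mS _] := maxS; apply: maximal_monotoneI.
  apply: le_monotone => x x' _ _ [y Sxy <-] [y' Sxy' <-] xx'.
  by rewrite ler_pM2l //; exact: monotone_le Sxy Sxy' xx'.
move=> x y relxy; exists (c^-1 * y); last by rewrite mulrA divff ?gt_eqF ?mul1r.
apply: (maximal_mem maxS) => u v Suv.
have /relxy : op_scale c S u (c * v) by exists v.
have -> : y - c * v = c * (c^-1 * y - v).
  by rewrite mulrBr mulrA divff ?gt_eqF ?mul1r.
by rewrite mulrCA pmulr_rge0.
Qed.

Lemma maximal_id : maximal_monotone (@op_id R).
Proof.
apply: surj_maximal.
- by apply: le_monotone => x x' y y' -> -> /ltW.
- by move=> t; exists (t / 2); rewrite /op_id /=; lra.
Qed.

Lemma maximal_zero : maximal_monotone (fun _ : R => [set (0 : R)]).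
Proof.
apply: surj_maximal.
- by apply: le_monotone => x x' y y' -> ->.
- by move=> t; exists t; rewrite /= subrr.
Qed.

(** * Continuity, images of intervals, and their endpoints *)

Lemma open_ball_sub D x : open D -> D x ->
  exists2 e, 0 < e & forall z, x - e < z < x + e -> D z.
Proof.
move=> oD Dx; have /nbhs_ballP[e /= e0 eD] := open_nbhs_nbhs (conj oD Dx).
exists e => // z xez; apply: eD; rewrite /ball /= ltr_distlC; lra.
Qed.

(** Since S x is a singleton, the graph points with coordinate sums x + f x + e and x + f x - e lie
    strictly to the right and left of x. Between their abscissae, monotonicity keeps f within e of f
    x. *)
Lemma single_valued_continuous S K f : maximal_monotone S -> open K ->
  single_valued_on K S f -> {within K, continuous f}.
Proof.
move=> maxS oK Sf; rewrite continuous_open_subspace // => x /set_mem Kx.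
have [mS _] := maxS; have Sfx z : K z -> S z (f z) by move=> /Sf ->.
have fx y : S x y -> y = f x by rewrite (Sf x Kx).
apply/cvgrPdist_le => e e0.
have [x1 S1] := minty (x + f x + e) maxS.
have [x2 S2] := minty (x + f x - e) maxS.
have xx1 : x < x1.
  have [h|h|h] := ltgtP x x1; first by [].
  + by have := monotone_le mS S1 (Sfx _ Kx) h; lra.
  + by move: S1; rewrite -h => /fx; lra.
have xx2 : x2 < x.
  have [h|h|h] := ltgtP x2 x; first by [].
  + by have := monotone_le mS (Sfx _ Kx) S2 h; lra.
  + by move: S2; rewrite h => /fx; lra.
near=> z.
have zx1 : z < x1 by near: z; exact: lt_nbhsl.
have zx2 : x2 < z by near: z; exact: lt_nbhsr.
have Kz : K z by near: z; exact: open_nbhs_nbhs (conj oK Kx).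
have := monotone_le mS (Sfx _ Kz) S1 zx1; have := monotone_le mS S2 (Sfx _ Kz) zx2.
by rewrite ler_norml; lra.
Unshelve. all: by end_near. Qed.

Lemma image_is_interval S D : maximal_monotone S -> is_interval D ->
  is_interval [set y | exists2 x, D x & S x y].
Proof.
move=> maxS iD y1 y2 [x1 D1 S1] [x2 D2 S2] y /andP[y1y yy2].
have [J [SJ Jx ne]] := resolvent_exists maxS; have [mS _] := maxS.
(* Away from both ends y1 < y2, so monotonicity orders x1 and x2; the intermediate value theorem
   then applies to t - J t. *)
have [->|yn1] := eqVneq y y1; first by exists x1.
have [->|yn2] := eqVneq y y2; first by exists x2.
have y1y2 : y1 < y2 by lra.
have x12 : x1 <= x2.
  by rewrite leNgt; apply/negP => /(monotone_le mS S2 S1); lra.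
have t12 : x1 + y1 <= x2 + y2 by lra.
have J1 := Jx _ _ S1; have J2 := Jx _ _ S2.
have neg : nondecreasing_nonexpansive (fun t => t - J t).
  by move=> a b ab; have := ne _ _ ab; lra.
have [|c /andP[c1 c2] cy] := @nonexpansive_IVT _ _ _ y neg t12.
  by rewrite J1 J2; lra.
exists (J c); last by rewrite -cy.
apply: (iD x1 x2) => //; have := ne _ _ c1; have := ne _ _ c2.
by rewrite J1 J2; lra.
Qed.

(** A point z of K outside D bounds D on one side, so the [inf] or [sup] on that side is a true
    endpoint lying between z and y, hence in K. Default values of [inf] and [sup] never
    intervene. *)
Lemma interval_boundary K D : is_interval K -> is_interval D ->
  ~ K (inf D) -> ~ K (sup D) -> (exists2 y, K y & D y) -> K `<=` D.
Proof.
move=> iK iD nKi nKs [y Ky Dy] z Kz; apply: contrapT => nDz.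
have [zy|yz|zy] := ltgtP z y; last by apply: nDz; rewrite zy.
- have zlb : lbound D z.
    move=> a Da; rewrite leNgt; apply/negP => az; apply: nDz.
    by apply: (iD a y) => //; lra.
  apply: nKi; apply: (iK z y) => //; apply/andP; split.
    by apply: lb_le_inf => //; exists y.
  by apply: ge_inf => //; exists z.
- have zub : ubound D z.
    move=> a Da; rewrite leNgt; apply/negP => az; apply: nDz.
    by apply: (iD y a) => //; lra.
  apply: nKs; apply: (iK y z) => //; apply/andP; split.
    by apply: ub_le_sup => //; exists z.
  by apply: ge_sup => //; exists y.
Qed.

(** * Pieces of uniform behaviour *)

(* Unlike in [strict_piece], continuity is not required: it is automatic for
   maximal monotone operators by [single_valued_continuous]. *)
Definition uniform_piece K S :=
  [\/ constant_piece K S,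
      exists2 f : R -> R, single_valued_on K S f &
        (forall x x', K x -> K x' -> x < x' -> f x < f x')
    | empty_piece K S].

Lemma uniform_pieceS K D S :
  K `<=` D -> uniform_piece D S -> uniform_piece K S.
Proof.
move=> KD [[c Sc]|[f Sf lef]|S0].
- by apply: Or31; exists c => x /KD; exact: Sc.
- apply: Or32; exists f => [x /KD|x x' /KD Dx /KD Dx']; first exact: Sf.
  exact: lef.
- by apply: Or33 => x /KD; exact: S0.
Qed.

Lemma uniform_piece_strict K S : maximal_monotone S -> open K ->
  uniform_piece K S ->
  [\/ constant_piece K S, strict_piece K S | empty_piece K S].
Proof.
move=> maxS oK [cS|[f Sf lef]|S0]; [exact: Or31| |exact: Or33].
apply: Or32; exists f; split=> //; first exact: single_valued_continuous Sf.
move=> [x y] [x' y'] /= [/= Kx Sxy] [/= Kx' Sxy'] xx'.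
move: Sxy Sxy'; rewrite (Sf x Kx) (Sf x' Kx') => -> ->.
have [h|h|h] := ltgtP x x'; last by rewrite h eqxx in xx'.
- by rewrite nmulr_rgt0 ?subr_lt0 //; exact: lef.
- by rewrite pmulr_rgt0 ?subr_gt0 //; exact: lef.
Qed.

Lemma strict_piece_uniform K S :
  [\/ constant_piece K S, strict_piece K S | empty_piece K S] ->
  uniform_piece K S.
Proof.
move=> [cS|[f [Sf _ mS]]|S0]; [exact: Or31| |exact: Or33].
apply: Or32; exists f => // x x' Kx Kx' xx'.
have gx z : K z -> gph (op_restrict S K) (z, f z).
  by move=> Kz; split=> //=; rewrite Sf.
have /= := mS (x, f x) (x', f x') (gx _ Kx) (gx _ Kx').
by rewrite lt_eqF // => /(_ isT); rewrite nmulr_rgt0 ?subr_lt0.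
Qed.

Lemma single_valued_add K S T f g : single_valued_on K S f ->
  single_valued_on K T g -> single_valued_on K (op_add S T) (f \+ g).
Proof.
move=> Sf Tg x Kx; apply/seteqP; split=> y.
- by move=> /op_addP[a [b []]]; rewrite Sf // Tg // => -> -> ->.
- by move=> ->; apply/op_addP; exists (f x), (g x); rewrite Sf // Tg.
Qed.

Lemma uniform_piece_add K S T : uniform_piece K S -> uniform_piece K T ->
  uniform_piece K (op_add S T).
Proof.
move=> [[c Sc]|[f Sf lef]|S0]; last first.
- move=> _; apply: Or33 => x Kx; apply/seteqP; split=> // y.
  by move=> /op_addP[a [b []]]; rewrite S0.
- move=> [[d Td]|[g Tg leg]|T0]; last first.
  + apply: Or33 => x Kx; apply/seteqP; split=> // y.
    by move=> /op_addP[a [b []]]; rewrite T0.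
  + apply: Or32; exists (f \+ g); first exact: single_valued_add.
    by move=> x x' Kx Kx' xx'; apply: ltrD; [exact: lef|exact: leg].
  + apply: Or32; exists (f \+ cst d); first exact: single_valued_add.
    by move=> x x' Kx Kx' xx'; rewrite /= ltrD2r; exact: lef.
- move=> [[d Td]|[g Tg leg]|T0]; last first.
  + apply: Or33 => x Kx; apply/seteqP; split=> // y.
    by move=> /op_addP[a [b []]]; rewrite T0.
  + apply: Or32; exists (cst c \+ g); first exact: single_valued_add.
    by move=> x x' Kx Kx' xx'; rewrite /= ltrD2l; exact: leg.
  + by apply: Or31; exists (c + d) => x Kx; rewrite (single_valued_add Sc Td Kx).
Qed.

Lemma uniform_piece_scale K S c : 0 < c -> uniform_piece K S ->
  uniform_piece K (op_scale c S).
Proof.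
move=> c0 [[d Sd]|[f Sf lef]|S0].
- by apply: Or31; exists (c * d) => x Kx; rewrite /op_scale Sd // image_set1.
- apply: Or32; exists (fun x => c * f x) => [x Kx|x x' Kx Kx' xx'].
    by rewrite /op_scale Sf // image_set1.
  by rewrite ltr_pM2l //; exact: lef.
- by apply: Or33 => x Kx; rewrite /op_scale S0 // image_set0.
Qed.

(** * From breakpoints to finite sets of avoided points, and back *)

Lemma open_piece (b : nat -> \bar R) i : open (piece b i).
Proof.
rewrite /piece; apply: (@openI _ [set x | (b i < x%:E)%E] [set x | (x%:E < b i.+1)%E]).
- case: (b i) => [r| |].
  + by rewrite [X in open X](_ : _ = [set x | r < x]); [exact: open_gt|by []].
  + rewrite [X in open X](_ : _ = set0); first exact: open0.
    by rewrite -subset0 => x /=; rewrite ltNge leey.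
  + rewrite [X in open X](_ : _ = setT); first exact: openT.
    by apply/seteqP; split=> x //= _; rewrite ltNyr.
- case: (b i.+1) => [r| |].
  + by rewrite [X in open X](_ : _ = [set x | x < r]); [exact: open_lt|by []].
  + rewrite [X in open X](_ : _ = setT); first exact: openT.
    by apply/seteqP; split=> x //= _; rewrite ltry.
  + rewrite [X in open X](_ : _ = set0); first exact: open0.
    by rewrite -subset0 => x /=; rewrite ltNge leNye.
Qed.

Lemma piece_is_interval (b : nat -> \bar R) i : is_interval (piece b i).
Proof.
move=> x y [bx xb] [bz zb] z /andP[xz zy]; split.
- by apply: lt_le_trans bx _; rewrite lee_fin.
- by apply: le_lt_trans zb; rewrite lee_fin.
Qed.

Lemma breakpoints_cover l (b : nat -> \bar R) x : breakpoints l b ->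
  exists2 i, (i < l)%N & piece b i x \/ b i = x%:E.
Proof.
move=> [b0 bl bS].
(* Scan the breakpoints upwards: either b n is still at most x, or x has been located. At n = l the
   former contradicts b l = +oo. *)
have [/(_ (leqnn l))|//] : ((l <= l)%N -> (b l <= x%:E)%E) \/
    exists2 i, (i < l)%N & piece b i x \/ b i = x%:E.
  elim: {1 3}l => [|n [IH|IH]]; [by left; rewrite b0 leNye| |by right].
  have [nl|nl] := leqP n.+1 l; last by left.
  have := IH (ltnW nl); rewrite le_eqVlt => /predU1P[bn|bn].
    by right; exists n => //; right.
  have [h|h] := leP (b n.+1) x%:E; [by left|right].
  by exists n => //; left.
by rewrite bl leNgt ltry.
Qed.

Definition avoids (s : seq R) K := forall x, x \in s -> ~ K x.

Lemma classT_uniform T : classT T -> exists S (s : seq R),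
  maximal_monotone_extension T S /\
  forall K, is_interval K -> avoids s K -> uniform_piece K S.
Proof.
(* [fine] sends the two infinite ends to 0, which only adds a point to avoid. An interval avoiding
   the list stays in the piece of any of its points. *)
move=> [l [b [bb [S extS pS]]]]; exists S, [seq fine (b i) | i <- iota 0 l.+1].
split=> // K iK avK.
have [[x Kx]|nK] := pselect (K !=set0); last first.
  by apply: Or33 => x Kx; case: nK; exists x.
have avb i z : (i <= l)%N -> b i = z%:E -> ~ K z.
  move=> il bz; apply: avK; apply/mapP; exists i; last by rewrite bz.
  by rewrite mem_iota ltnS.
have [i il [[bx xb]|bx]] := breakpoints_cover x bb; last first.
  by case: (avb i x (ltnW il) bx).
apply: (@uniform_pieceS _ (piece b i)).
  move=> z Kz; split; rewrite ltNge; apply/negP => h.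
  - case bi : (b i) => [r| |].
    + apply: (avb i r (ltnW il) bi); apply: (iK z x) => //.
      by move: h bx; rewrite bi lee_fin lte_fin => -> /ltW ->.
    + by move: bx; rewrite bi ltNge leey.
    + by move: h; rewrite bi leNgt ltNyr.
  - case bi : (b i.+1) => [r| |].
    + apply: (avb i.+1 r il bi); apply: (iK x z) => //.
      by move: h xb; rewrite bi lee_fin lte_fin => -> /ltW ->.
    + by move: h; rewrite bi leNgt ltry.
    + by move: xb; rewrite bi ltNge leNye.
exact/strict_piece_uniform/pS.
Qed.

Lemma uniform_classT T S (s : seq R) : maximal_monotone_extension T S ->
  (forall K, open K -> is_interval K -> avoids s K -> uniform_piece K S) ->
  classT T.
Proof.
move=> extS uS; have [maxS _] := extS.
pose s' := sort <=%R (undup s).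
(* The default value of [nth] supplies the last breakpoint +oo. *)
pose b i := nth +oo%E (-oo%E :: map EFin s') i.
exists (size s').+1, b.
have bE i : (i < size s')%N -> b i.+1 = (nth 0 s' i)%:E.
  by move=> il; rewrite /b /= (nth_map 0).
have bl : b (size s').+1 = +oo%E by rewrite /b /= nth_default // size_map.
have s'lt : sorted <%R s' by rewrite lt_sorted_uniq_le sort_uniq undup_uniq sort_le_sorted.
have bmono i j : (i < j)%N -> (j <= (size s').+1)%N -> (b i < b j)%E.
  case: j => // j ij; rewrite ltnS leq_eqVlt => /predU1P[jE|jl].
    rewrite jE bl; case: i ij => [|i] ij; first by rewrite /b /= ltNye.
    by rewrite bE ?ltry // -jE.
  rewrite bE //; case: i ij => [|i] ij; first by rewrite /b /= ltNyr.
  rewrite bE ?(ltn_trans _ jl) // lte_fin.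
  by rewrite (lt_sorted_ltn_nth 0 s'lt) ?inE // (ltn_trans _ jl).
split; first by split=> // i il; exact: bmono.
exists S => // i il; apply: uniform_piece_strict => //; first exact: open_piece.
apply: uS; [exact: open_piece|exact: piece_is_interval|].
move=> x; rewrite -mem_undup -(mem_sort <=%R) => /(nthP 0)[j jl <-].
rewrite -/s' in jl *; move=> [lo hi]; rewrite -bE // in lo hi.
(* The listed point is b j.+1; lying in piece i would put j.+1 strictly between i and i.+1. *)
have [ij|ji] := leqP i.+1 j.+1.
- have [jE|ij'] := eqVneq i.+1 j.+1; first by rewrite jE ltxx in hi.
  have := bmono i.+1 j.+1; rewrite ltn_neqAle ij' ij ltnS ltnW // => /(_ isT isT).
  by rewrite ltNge (ltW hi).
- have [jE|ij'] := eqVneq i j.+1; first by rewrite jE ltxx in lo.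
  have := bmono j.+1 i; rewrite ltn_neqAle eq_sym ij' -ltnS ji (ltnW il).
  by move=> /(_ isT isT); rewrite ltNge (ltW lo).
Qed.

(** * Stability under sums and nonnegative multiples *)

Lemma classT_add T1 T2 : classT T1 -> classT T2 -> classT (op_add T1 T2).
Proof.
move=> /classT_uniform[S1 [s1 [[max1 ext1] u1]]].
move=> /classT_uniform[S2 [s2 [[max2 ext2] u2]]].
have [[x0 [y1 [y2 [S1x S2x]]]]|dis] :=
  pselect (exists x y1 y2, S1 x y1 /\ S2 x y2).
- apply: (@uniform_classT _ (op_add S1 S2) (s1 ++ s2)).
    split; first exact: maximal_add S1x S2x.
    move=> [x y]; rewrite /gph /= => /op_addP[a [b [Ta Tb ->]]]; apply/op_addP; exists a, b.
    by split=> //; [exact: (ext1 (x, a))|exact: (ext2 (x, b))].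
  move=> K oK iK avK; apply: uniform_piece_add.
  + by apply: u1 => // x xs; apply: avK; rewrite mem_cat xs.
  + by apply: u2 => // x xs; apply: avK; rewrite mem_cat xs orbT.
- apply: (@uniform_classT _ (fun _ => [set 0]) [::]).
    split; first exact: maximal_zero.
    move=> [x y]; rewrite /gph /= => /op_addP[a [b [Ta Tb _]]]; case: dis; exists x, a, b.
    by split=> //; [exact: (ext1 (x, a))|exact: (ext2 (x, b))].
  by move=> K _ _ _; apply: Or31; exists 0 => x _.
Qed.

Lemma classT_scale T c : classT T -> 0 <= c -> classT (op_scale c T).
Proof.
move=> /classT_uniform[S [s [[maxS ext] u]]]; rewrite le_eqVlt.
move=> /predU1P[<-|c0].
(* For c = 0 the multiple is zero on the domain of T only, and extends to the zero operator on the
   line. *)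
- apply: (@uniform_classT _ (fun _ => [set 0]) [::]).
    split; first exact: maximal_zero.
    by move=> [x y]; rewrite /gph /= => -[z _ <-]; rewrite mul0r.
  by move=> K _ _ _; apply: Or31; exists 0 => x _.
- apply: (@uniform_classT _ (op_scale c S) s).
    split; first exact: maximal_scale.
    by move=> [x y]; rewrite /gph /= => -[z Tz <-]; exists z => //; exact: (ext (x, z)).
  by move=> K _ iK avK; apply: uniform_piece_scale => //; exact: u.
Qed.

(** * Stability under inversion *)

(** Near each y in K the set S x has values above and below y, so a preimage of y other than x would
    break monotonicity. *)
Lemma uniform_piece_inv_vertical K S x : maximal_monotone S -> open K ->
  K `<=` S x -> uniform_piece K (op_inv S).
Proof.
move=> [mS _] oK KS; apply: Or31; exists x => y Ky.
have [e e0 eK] := open_ball_sub oK Ky.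
apply/seteqP; split=> z /=; last by move=> ->; exact: KS.
move=> Szy; have [zx|xz|//] := ltgtP z x.
- have /KS Sx : K (y - e / 2) by apply: eK; lra.
  by have := monotone_le mS Szy Sx zx; lra.
- have /KS Sx : K (y + e / 2) by apply: eK; lra.
  by have := monotone_le mS Sx Szy xz; lra.
Qed.

Lemma uniform_piece_inv K D S : maximal_monotone S -> open K -> open D ->
  uniform_piece D S -> K `<=` [set y | exists2 x, D x & S x y] ->
  uniform_piece K (op_inv S).
Proof.
move=> [mS _] oK oD [[c Sc]|[f Sf lef]|S0] KS.
(* A constant piece has a one-point image, so the open set K inside it is empty. *)
- apply: Or33 => y Ky; have [e e0 eK] := open_ball_sub oK Ky.
  have Kc z : K z -> z = c by move=> /KS[x Dx]; rewrite Sc.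
  have /Kc yc := Ky; have /Kc : K (y + e / 2) by apply: eK; lra.
  by move: yc => -> ?; exfalso; lra.
- have Sfx x : D x -> S x (f x) by move=> /Sf ->.
  have [|g gS] := @choice _ _ (fun y x => K y -> D x /\ S x y).
    move=> y; have [/KS[x Dx Sx]|nK] := pselect (K y); last by exists 0.
    by exists x.
  have fg y : K y -> f (g y) = y by move=> /gS[Dg]; rewrite Sf.
  apply: Or32; exists g => [y Ky|y y' Ky Ky' yy'].
  + have [Dx Sx] := gS y Ky; have [e e0 eD] := open_ball_sub oD Dx.
    apply/seteqP; split=> z /=; last by move=> ->.
    move=> Szy; have [zx|xz|//] := ltgtP z (g y).
    (* The preimage z may lie outside D, where f says nothing. The point w is strictly between z and
       g y and close enough to g y to be in D; f w < y then contradicts monotonicity. *)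
    * pose w := Num.max ((z + g y) / 2) (g y - e / 2).
      have wx : w < g y by rewrite gt_max; apply/andP; split; lra.
      have zw : z < w by rewrite lt_max; apply/orP; left; lra.
      have Dw : D w.
        apply: eD; have : g y - e / 2 <= w by rewrite le_max lexx orbT.
        by lra.
      have := monotone_le mS Szy (Sfx w Dw) zw.
      by have := lef w (g y) Dw Dx wx; rewrite fg //; lra.
    * pose w := Num.min ((z + g y) / 2) (g y + e / 2).
      have wx : g y < w by rewrite lt_min; apply/andP; split; lra.
      have zw : w < z by rewrite gt_min; apply/orP; left; lra.
      have Dw : D w.
        apply: eD; have : w <= g y + e / 2 by rewrite ge_min lexx orbT.
        by lra.
      have := monotone_le mS (Sfx w Dw) Szy zw.
      by have := lef (g y) w Dx Dw wx; rewrite fg //; lra.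
  + have [Dg _] := gS y Ky; have [Dg' _] := gS y' Ky'.
    have [//|h|h] := ltgtP (g y) (g y').
    * by have := lef _ _ Dg' Dg h; rewrite !fg //; lra.
    * by move: yy'; rewrite -(fg y) // -(fg y') // h ltxx.
- by apply: Or33 => y /KS[x Dx]; rewrite S0.
Qed.

Lemma classT_inv T : classT T -> classT (op_inv T).
Proof.
move=> [l [b [bb [S [maxS ext] pS]]]].
pose img D := [set y | exists2 x, D x & S x y].
pose bd D : seq R := [:: inf (img D); sup (img D)].
(* For i = 0, [fine] gives 0 in place of -oo, which merely adds points to avoid. *)
pose s := flatten [seq bd (piece b i) ++ bd [set fine (b i)] | i <- iota 0 l].
apply: (@uniform_classT _ (op_inv S) s).
  by split; [exact: maximal_inv|move=> [x y] Tyx; exact: (ext (y, x))].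
move=> K oK iK avK.
have sub i D : (i < l)%N -> D = piece b i \/ D = [set fine (b i)] ->
    is_interval D -> (exists2 y, K y & img D y) -> K `<=` img D.
  move=> il DE iD; apply: interval_boundary => //;
    [exact: image_is_interval| |];
    by apply: avK; apply/flattenP;
      exists (bd (piece b i) ++ bd [set fine (b i)]);
      [apply/mapP; exists i; rewrite // mem_iota
      |case: DE => ->; rewrite !(mem_cat, inE) eqxx ?orbT].
have [[y Ky [x Sxy]]|nK] := pselect (exists2 y, K y & exists x, S x y);
    last first.
  apply: Or33 => y Ky; apply/seteqP; split=> // x Sxy.
  by case: nK; exists y => //; exists x.
have [i il [px|bx]] := breakpoints_cover x bb.
- apply: (@uniform_piece_inv _ (piece b i)) => //; first exact: open_piece.
    exact/strict_piece_uniform/pS.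
  apply: (sub i) => //; [by left|exact: piece_is_interval|].
  by exists y => //; exists x.
- apply: (@uniform_piece_inv_vertical _ _ x) => //.
  suff KD : K `<=` img [set x] by move=> z /KD[_ ->].
  apply: (sub i) => //; [by right; rewrite bx| |by exists y => //; exists x].
  by move=> u v -> -> w; rewrite -eq_le => /eqP.
Qed.

Lemma classT_id : classT (@op_id R).
Proof.
apply: (@uniform_classT _ (@op_id R) [::]).
  by split; [exact: maximal_id|].
by move=> K _ _ _; apply: Or32; exists id.
Qed.

End MaximalMonotone.

Theorem proposition3p3 (R : realType) :
  (forall (T : operator R) (lambda : R),
     classT T -> 0 <= lambda -> classT (op_scale lambda T)) /\
  (forall T1 T2 : operator R,
     classT T1 -> classT T2 -> classT (op_add T1 T2)) /\
  (forall T : operator R, classT T -> classT (op_inv T)) /\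
  (forall (T : operator R) (lambda : R),
     classT T -> 0 < lambda ->
     classT (op_inv (op_add (@op_id R) (op_scale lambda T)))) /\
  (forall T1 T2 : operator R,
     classT T1 -> classT T2 ->
     classT (op_inv (op_add (op_inv T1) (op_inv T2)))).
Proof.
split; first by move=> T c; exact: classT_scale.
split; first by move=> T1 T2; exact: classT_add.
split; first by move=> T; exact: classT_inv.
split=> [T c cT c0|T1 T2 cT1 cT2].
- apply/classT_inv/classT_add; first exact: classT_id.
  exact: classT_scale cT (ltW c0).
- by apply/classT_inv/classT_add; exact: classT_inv.
Qed.
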